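(* The complexification $\mathbb{B}=\mathbb{D}+\mathbf{i}\mathbb{D}$ of the $f$-algebra $\mathbb{D}$ is normal; that is, for all $\psi,\varphi\in\mathbb{B}$ with $|\psi|_{\mathbf{j}}\wedge|\varphi|_{\mathbf{j}}=0$ one has $\mathbb{B}=\{\psi\}^{\perp}+\{\varphi\}^{\perp}$.
   Context: $\mathbb{D}=\{x+\mathbf{j}y:x,y\in\mathbb{R}\}$, $\mathbf{j}^2=1$, $\mathbf{j}\notin\mathbb{R}$, is the algebra of hyperbolic numbers. With $\mathbf{e}_1=\frac{1+\mathbf{j}}{2}$, $\mathbf{e}_2=\frac{1-\mathbf{j}}{2}$, each $z=x+\mathbf{j}y\in\mathbb{D}$ is $z=\pi_1(z)\mathbf{e}_1+\pi_2(z)\mathbf{e}_2$, where $\pi_1(z)=x+y$, $\pi_2(z)=x-y$. $\mathbb{D}$ is an Archimedean $f$-algebra for the order: $z\le w$ iff $\pi_k(z)\le\pi_k(w)$ for $k=1,2$; so $z\wedge w$ (infimum) is the componentwise minimum. $\mathbb{B}=\mathbb{D}+\mathbf{i}\mathbb{D}$ is the commutative algebra of bicomplex numbers $a+b\mathbf{i}+c\mathbf{j}+d\mathbf{k}$ ($a,b,c,d\in\mathbb{R}$), with $\mathbf{i}^2=\mathbf{k}^2=-1$, $\mathbf{j}^2=1$, $\mathbf{i}\mathbf{k}=\mathbf{k}\mathbf{i}=\mathbf{j}$. Each $\omega\in\mathbb{B}$ is uniquely $\omega=\mathrm{Re}_{\mathbf{j}}(\omega)+\mathbf{i}\,\mathrm{Im}_{\mathbf{j}}(\omega)$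 with $\mathrm{Re}_{\mathbf{j}}(\omega),\mathrm{Im}_{\mathbf{j}}(\omega)\in\mathbb{D}$. The $\mathbf{j}$-modulus is $|\omega|_{\mathbf{j}}=\sqrt{\mathrm{Re}_{\mathbf{j}}(\omega)^2+\mathrm{Im}_{\mathbf{j}}(\omega)^2}\in\mathbb{D}$, where the square root of an element $\ge0$ of $\mathbb{D}$ is its unique square root that is $\ge0$ (taken componentwise in the basis $\mathbf{e}_1,\mathbf{e}_2$). It is the modulus of $\omega$ in the complexification $\mathbb{D}+\mathbf{i}\mathbb{D}$, i.e. $\sup\{\mathrm{Re}_{\mathbf{j}}(\omega)\cos\theta+\mathrm{Im}_{\mathbf{j}}(\omega)\sin\theta:\theta\in[0,2\pi]\}$. For $\upsilon\in\mathbb{B}$, $\{\upsilon\}^{\perp}=\{\omega\in\mathbb{B}:|\upsilon|_{\mathbf{j}}\wedge|\omega|_{\mathbf{j}}=0\}$. *)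

(* Defs.v *)
From HB Require Import structures.
From mathcomp Require Import all_boot all_order all_algebra.
From mathcomp Require Import ring lra.
From mathcomp Require Import boolp classical_sets reals.

Set Implicit Arguments.
Unset Strict Implicit.
Unset Printing Implicit Defensive.
Import Order.TTheory GRing.Theory Num.Theory.
Local Open Scope ring_scope.

(* [Hyp x y] is the hyperbolic number x + j y. *)
Record hyperbolic (R : Type) : Type := Hyp { hyp_re : R; hyp_im : R }.

Definition pair_of_hyp (R : Type) (z : hyperbolic R) := (hyp_re z, hyp_im z).
Definition hyp_of_pair (R : Type) (p : R * R) := Hyp p.1 p.2.

Lemma pair_of_hypK (R : Type) : cancel (@pair_of_hyp R) (@hyp_of_pair R).
Proof. by case. Qed.

HB.instance Definition _ (R : realType) :=
  Choice.copy (hyperbolic R) (can_type (@pair_of_hypK R)).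

Section HyperbolicAlgebra.
Context {R : realType}.
Implicit Types (z w u : hyperbolic R) (a : R).

Definition hyp_add z w := Hyp (hyp_re z + hyp_re w) (hyp_im z + hyp_im w).
Definition hyp_opp z := Hyp (- hyp_re z) (- hyp_im z).
Definition hyp_mul z w :=
  Hyp (hyp_re z * hyp_re w + hyp_im z * hyp_im w)
      (hyp_re z * hyp_im w + hyp_im z * hyp_re w).
Definition hyp_scale a z := Hyp (a * hyp_re z) (a * hyp_im z).

Fact hyp_addA : associative hyp_add.
Proof. by move=> [? ?] [? ?] [? ?]; congr Hyp; rewrite /= addrA. Qed.
Fact hyp_addC : commutative hyp_add.
Proof. by move=> [? ?] [? ?]; congr Hyp; rewrite /= addrC. Qed.
Fact hyp_add0 : left_id (Hyp 0 0) hyp_add.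
Proof. by move=> [? ?]; congr Hyp; rewrite /= add0r. Qed.
Fact hyp_addN : left_inverse (Hyp 0 0) hyp_opp hyp_add.
Proof. by move=> [? ?]; congr Hyp; rewrite /= addNr. Qed.

HB.instance Definition _ :=
  GRing.isZmodule.Build (hyperbolic R) hyp_addA hyp_addC hyp_add0 hyp_addN.

Fact hyp_mulA : associative hyp_mul.
Proof. by move=> [? ?] [? ?] [? ?]; congr Hyp => /=; ring. Qed.
Fact hyp_mulC : commutative hyp_mul.
Proof. by move=> [? ?] [? ?]; congr Hyp => /=; ring. Qed.
Fact hyp_mul1 : left_id (Hyp 1 0) hyp_mul.
Proof. by move=> [? ?]; congr Hyp => /=; ring. Qed.
Fact hyp_mulDl : left_distributive hyp_mul +%R.
Proof. by move=> [? ?] [? ?] [? ?]; congr Hyp => /=; ring. Qed.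
Fact hyp_1_neq0 : Hyp 1 0 != 0 :> hyperbolic R.
Proof. by apply/eqP => -[] /eqP; rewrite oner_eq0. Qed.

HB.instance Definition _ := GRing.Zmodule_isComNzRing.Build (hyperbolic R)
  hyp_mulA hyp_mulC hyp_mul1 hyp_mulDl hyp_1_neq0.

Fact hyp_scaleA a b z : hyp_scale a (hyp_scale b z) = hyp_scale (a * b) z.
Proof. by congr Hyp; rewrite /= mulrA. Qed.
Fact hyp_scale1 : left_id 1 hyp_scale.
Proof. by case=> *; congr Hyp; rewrite /= mul1r. Qed.
Fact hyp_scaleDr : right_distributive hyp_scale +%R.
Proof. by move=> *; congr Hyp; rewrite /= mulrDr. Qed.
Fact hyp_scaleDl z : {morph hyp_scale^~ z : a b / a + b}.
Proof. by move=> *; congr Hyp; rewrite /= mulrDl. Qed.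

HB.instance Definition _ := GRing.Zmodule_isLmodule.Build R (hyperbolic R)
  hyp_scaleA hyp_scale1 hyp_scaleDr hyp_scaleDl.

Fact hyp_scaleAl a z w : a *: (z * w) = (a *: z) * w.
Proof. by congr Hyp => /=; ring. Qed.

HB.instance Definition _ :=
  GRing.Lmodule_isLalgebra.Build R (hyperbolic R) hyp_scaleAl.
HB.instance Definition _ :=
  GRing.Lalgebra_isComAlgebra.Build R (hyperbolic R).

Definition hyp_j : hyperbolic R := Hyp 0 1.
Definition hyp_e1 : hyperbolic R := 2^-1 *: (1 + hyp_j).
Definition hyp_e2 : hyperbolic R := 2^-1 *: (1 - hyp_j).
Definition pi1 z := hyp_re z + hyp_im z.
Definition pi2 z := hyp_re z - hyp_im z.

(* The hyperbolic number with coordinates a, b in the basis e1, e2. *)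
Definition idem a b : hyperbolic R := a *: hyp_e1 + b *: hyp_e2.

Lemma hypE z : z = (hyp_re z)%:A + hyp_im z *: hyp_j.
Proof. by case: z => x y; congr Hyp => /=; ring. Qed.

Lemma hyp_jj : hyp_j * hyp_j = 1.
Proof. by congr Hyp => /=; ring. Qed.

Lemma pi1_idem a b : pi1 (idem a b) = a.
Proof. by rewrite /pi1 /=; field. Qed.

Lemma pi2_idem a b : pi2 (idem a b) = b.
Proof. by rewrite /pi2 /=; field. Qed.

Lemma hyp_idemE z : z = pi1 z *: hyp_e1 + pi2 z *: hyp_e2.
Proof. by case: z => x y; rewrite /pi1 /pi2; congr Hyp => /=; field. Qed.

Lemma hyp_eqP z w : pi1 z = pi1 w -> pi2 z = pi2 w -> z = w.
Proof. by move=> h1 h2; rewrite (hyp_idemE z) (hyp_idemE w) h1 h2. Qed.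

Lemma pi1D z w : pi1 (z + w) = pi1 z + pi1 w.
Proof. by rewrite /pi1 /=; ring. Qed.
Lemma pi2D z w : pi2 (z + w) = pi2 z + pi2 w.
Proof. by rewrite /pi2 /=; ring. Qed.
Lemma pi1M z w : pi1 (z * w) = pi1 z * pi1 w.
Proof. by rewrite /pi1 /=; ring. Qed.
Lemma pi2M z w : pi2 (z * w) = pi2 z * pi2 w.
Proof. by rewrite /pi2 /=; ring. Qed.
Lemma pi1Z a z : pi1 (a *: z) = a * pi1 z.
Proof. by rewrite /pi1 /=; ring. Qed.
Lemma pi2Z a z : pi2 (a *: z) = a * pi2 z.
Proof. by rewrite /pi2 /=; ring. Qed.
Lemma pi1_0 : pi1 0 = 0.
Proof. by rewrite /pi1 /= addr0. Qed.
Lemma pi2_0 : pi2 0 = 0.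
Proof. by rewrite /pi2 /= subr0. Qed.

End HyperbolicAlgebra.

Section HyperbolicOrder.
Context {R : realType}.
Implicit Types (z w u : hyperbolic R).

Definition hyp_le z w := (pi1 z <= pi1 w) && (pi2 z <= pi2 w).
Definition hyp_meet z w :=
  idem (Num.min (pi1 z) (pi1 w)) (Num.min (pi2 z) (pi2 w)).
Definition hyp_join z w :=
  idem (Num.max (pi1 z) (pi1 w)) (Num.max (pi2 z) (pi2 w)).

Fact hyp_le_refl : reflexive hyp_le.
Proof. by move=> z; rewrite /hyp_le !lexx. Qed.
Fact hyp_le_anti : antisymmetric hyp_le.
Proof.
move=> z w /andP[/andP[h1 h2] /andP[h3 h4]].
by apply: hyp_eqP; apply/le_anti/andP.
Qed.
Fact hyp_le_trans : transitive hyp_le.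
Proof.
move=> w z u /andP[h1 h2] /andP[h3 h4].
by apply/andP; split; [exact: le_trans h3 | exact: le_trans h4].
Qed.

HB.instance Definition _ := Order.Le_isPOrder.Build ring_display (hyperbolic R)
  hyp_le_refl hyp_le_anti hyp_le_trans.

Lemma hyp_leE z w : (z <= w) = (pi1 z <= pi1 w) && (pi2 z <= pi2 w).
Proof. by []. Qed.

Fact hyp_meetP z w u : (z <= hyp_meet w u) = (z <= w) && (z <= u).
Proof. by rewrite !hyp_leE pi1_idem pi2_idem !le_min andbACA. Qed.
Fact hyp_joinP z w u : (hyp_join z w <= u) = (z <= u) && (w <= u).
Proof. by rewrite !hyp_leE pi1_idem pi2_idem !ge_max andbACA. Qed.

HB.instance Definition _ := Order.POrder_MeetJoin_isLattice.Build
  ring_display (hyperbolic R) hyp_meetP hyp_joinP.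

Lemma pi1_meet z w : pi1 (Order.meet z w) = Num.min (pi1 z) (pi1 w).
Proof. exact: pi1_idem. Qed.
Lemma pi2_meet z w : pi2 (Order.meet z w) = Num.min (pi2 z) (pi2 w).
Proof. exact: pi2_idem. Qed.

(* The next five lemmas say that the hyperbolic numbers are an Archimedean
   f-algebra. *)
Lemma hyp_leD2l u z w : (u + z <= u + w) = (z <= w).
Proof. by rewrite !hyp_leE !pi1D !pi2D !lerD2l. Qed.

Lemma hyp_scale_ge0 (a : R) z : 0 <= a -> 0 <= z -> 0 <= a *: z.
Proof.
move=> a0; rewrite !hyp_leE pi1Z pi2Z pi1_0 pi2_0 => /andP[z1 z2].
by rewrite !mulr_ge0.
Qed.

Lemma hyp_mul_ge0 z w : 0 <= z -> 0 <= w -> 0 <= z * w.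
Proof.
rewrite !hyp_leE pi1M pi2M pi1_0 pi2_0 => /andP[z1 z2] /andP[w1 w2].
by rewrite !mulr_ge0.
Qed.

Lemma hyp_falg u z w : 0 <= u -> Order.meet z w = 0 -> Order.meet (u * z) w = 0.
Proof.
rewrite hyp_leE pi1_0 pi2_0 => /andP[u1 u2] zw.
have minM (a b c : R) : 0 <= a -> Num.min b c = 0 -> Num.min (a * b) c = 0.
  move=> a0 bc0; have /andP[b0 c0] : (0 <= b) && (0 <= c).
    by rewrite -le_min bc0.
  case: (leP b c) bc0 => _ ->; first by rewrite mulr0; apply/min_idPl.
  by apply/min_idPr; rewrite mulr_ge0.
apply: hyp_eqP.
- by rewrite pi1_meet pi1M pi1_0 minM // -pi1_meet zw pi1_0.
- by rewrite pi2_meet pi2M pi2_0 minM // -pi2_meet zw pi2_0.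
Qed.

Lemma hyp_archi z w : (forall n : nat, n%:R *: z <= w) -> z <= 0.
Proof.
move=> h.
have archi (a b : R) : (forall n : nat, n%:R * a <= b) -> a <= 0.
  move=> ab; rewrite leNgt; apply/negP => a0.
  have b0 : 0 <= b by have := ab 0%N; rewrite mul0r.
  have := Num.Theory.archi_boundP (divr_ge0 b0 (ltW a0)).
  by rewrite ltr_pdivrMr // ltNge ab.
rewrite hyp_leE pi1_0 pi2_0; apply/andP; split.
- by apply: (archi _ (pi1 w)) => n; move: (h n); rewrite hyp_leE pi1Z => /andP[].
- by apply: (archi _ (pi2 w)) => n; move: (h n); rewrite hyp_leE pi2Z => /andP[].
Qed.

(* Only meaningful for z >= 0, as Num.sqrt is 0 on negative numbers. *)
Definition hyp_sqrt z := idem (Num.sqrt (pi1 z)) (Num.sqrt (pi2 z)).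

Lemma hyp_sqrt_ge0 z : 0 <= hyp_sqrt z.
Proof. by rewrite hyp_leE pi1_idem pi2_idem pi1_0 pi2_0 !sqrtr_ge0. Qed.

Lemma sqr_hyp_sqrt z : 0 <= z -> hyp_sqrt z ^+ 2 = z.
Proof.
rewrite hyp_leE pi1_0 pi2_0 => /andP[z1 z2]; rewrite expr2.
by apply: hyp_eqP; rewrite ?pi1M ?pi2M ?pi1_idem ?pi2_idem -expr2 sqr_sqrtr.
Qed.

Lemma hyp_sqrt_unique z w : 0 <= w -> w ^+ 2 = z -> w = hyp_sqrt z.
Proof.
rewrite hyp_leE pi1_0 pi2_0 => /andP[w1 w2] <-; rewrite expr2.
apply: hyp_eqP; rewrite ?pi1_idem ?pi2_idem ?pi1M ?pi2M -expr2 sqrtr_sqr.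
- by rewrite ger0_norm.
- by rewrite ger0_norm.
Qed.

End HyperbolicOrder.

(* [Bic z w] is the bicomplex number z + i w, with z and w hyperbolic. *)
Record bicomplex (R : Type) : Type :=
  Bic { Rej : hyperbolic R; Imj : hyperbolic R }.

Definition pair_of_bic (R : Type) (v : bicomplex R) := (Rej v, Imj v).
Definition bic_of_pair (R : Type) (p : hyperbolic R * hyperbolic R) :=
  Bic p.1 p.2.

Lemma pair_of_bicK (R : Type) : cancel (@pair_of_bic R) (@bic_of_pair R).
Proof. by case. Qed.

HB.instance Definition _ (R : realType) :=
  Choice.copy (bicomplex R) (can_type (@pair_of_bicK R)).

Section BicomplexAlgebra.
Context {R : realType}.
Implicit Types (v w : bicomplex R) (a : R).

Definition bic_add v w := Bic (Rej v + Rej w) (Imj v + Imj w).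
Definition bic_opp v := Bic (- Rej v) (- Imj v).
Definition bic_mul v w :=
  Bic (Rej v * Rej w - Imj v * Imj w) (Rej v * Imj w + Imj v * Rej w).
Definition bic_scale a v := Bic (a *: Rej v) (a *: Imj v).

Fact bic_addA : associative bic_add.
Proof. by move=> [? ?] [? ?] [? ?]; congr Bic; rewrite /= addrA. Qed.
Fact bic_addC : commutative bic_add.
Proof. by move=> [? ?] [? ?]; congr Bic; rewrite /= addrC. Qed.
Fact bic_add0 : left_id (Bic 0 0) bic_add.
Proof. by move=> [? ?]; congr Bic; rewrite /= add0r. Qed.
Fact bic_addN : left_inverse (Bic 0 0) bic_opp bic_add.
Proof. by move=> [? ?]; congr Bic; rewrite /= addNr. Qed.

HB.instance Definition _ :=
  GRing.isZmodule.Build (bicomplex R) bic_addA bic_addC bic_add0 bic_addN.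

Fact bic_mulA : associative bic_mul.
Proof. by move=> [? ?] [? ?] [? ?]; congr Bic => /=; ring. Qed.
Fact bic_mulC : commutative bic_mul.
Proof. by move=> [? ?] [? ?]; congr Bic => /=; ring. Qed.
Fact bic_mul1 : left_id (Bic 1 0) bic_mul.
Proof. by move=> [? ?]; congr Bic => /=; ring. Qed.
Fact bic_mulDl : left_distributive bic_mul +%R.
Proof. by move=> [? ?] [? ?] [? ?]; congr Bic => /=; ring. Qed.
Fact bic_1_neq0 : Bic 1 0 != 0 :> bicomplex R.
Proof. by apply/eqP => -[] /eqP; rewrite oner_eq0. Qed.

HB.instance Definition _ := GRing.Zmodule_isComNzRing.Build (bicomplex R)
  bic_mulA bic_mulC bic_mul1 bic_mulDl bic_1_neq0.

Fact bic_scaleA a b v : bic_scale a (bic_scale b v) = bic_scale (a * b) v.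
Proof. by congr Bic; rewrite /= scalerA. Qed.
Fact bic_scale1 : left_id 1 bic_scale.
Proof. by case=> *; congr Bic; rewrite /= scale1r. Qed.
Fact bic_scaleDr : right_distributive bic_scale +%R.
Proof. by move=> *; congr Bic; rewrite /= scalerDr. Qed.
Fact bic_scaleDl v : {morph bic_scale^~ v : a b / a + b}.
Proof. by move=> *; congr Bic; rewrite /= scalerDl. Qed.

HB.instance Definition _ := GRing.Zmodule_isLmodule.Build R (bicomplex R)
  bic_scaleA bic_scale1 bic_scaleDr bic_scaleDl.

Fact bic_scaleAl a v w : a *: (v * w) = (a *: v) * w.
Proof.
by congr Bic; rewrite /= -!scalerAl -?scalerBr -?scalerDr.
Qed.

HB.instance Definition _ :=
  GRing.Lmodule_isLalgebra.Build R (bicomplex R) bic_scaleAl.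
HB.instance Definition _ :=
  GRing.Lalgebra_isComAlgebra.Build R (bicomplex R).

Definition bic_of_hyp (z : hyperbolic R) : bicomplex R := Bic z 0.
Definition bic_i : bicomplex R := Bic 0 1.
Definition bic_j : bicomplex R := bic_of_hyp hyp_j.
(* The sign makes i k = j, which with i^2 = -1 forces k = - i j. *)
Definition bic_k : bicomplex R := Bic 0 (- hyp_j).

Lemma bicE v : v = bic_of_hyp (Rej v) + bic_i * bic_of_hyp (Imj v).
Proof. by case: v => z w; congr Bic => /=; ring. Qed.

Lemma bic_ii : bic_i * bic_i = -1.
Proof. by congr Bic => /=; ring. Qed.

Lemma bic_jj : bic_j * bic_j = 1.
Proof. by congr Bic; rewrite /= ?hyp_jj; ring. Qed.

Lemma bic_kk : bic_k * bic_k = -1.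
Proof. by congr Bic; rewrite /= ?mulrNN ?hyp_jj; ring. Qed.

Lemma bic_ik : bic_i * bic_k = bic_j.
Proof. by congr Bic => /=; ring. Qed.

Lemma bic_basisE v : v = (hyp_re (Rej v))%:A + hyp_re (Imj v) *: bic_i
  + hyp_im (Rej v) *: bic_j + (- hyp_im (Imj v)) *: bic_k.
Proof. by case: v => -[a c] [b d]; congr Bic; congr Hyp => /=; ring. Qed.

Definition jmod v : hyperbolic R := hyp_sqrt (Rej v ^+ 2 + Imj v ^+ 2).

Definition perp v : set (bicomplex R) :=
  [set w | Order.meet (jmod v) (jmod w) = 0]%classic.

End BicomplexAlgebra.

(* Main.v *)
Require Import Defs.
From mathcomp Require Import all_boot all_order all_algebra.
From mathcomp Require Import ring.
From mathcomp Require Import boolp classical_sets reals.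
Import Order.TTheory GRing.Theory Num.Theory.
Local Open Scope classical_set_scope.
Local Open Scope ring_scope.

(* On nonnegative elements z /\ w = 0 means z * w = 0, so j-disjointness of psi
   and phi reads |psi| * |phi| = 0. Splitting this componentwise gives an
   idempotent e of D with e |psi| = 0 and (1 - e) |phi| = 0, and every
   w = e w + (1 - e) w is then a decomposition along the two perps. *)

(** If [x <= y], the minimum is [x], and [y = 0] squeezes [x] to 0. Otherwise [x > y >= 0] is
    nonzero, so only [y] can make the product vanish. *)
Lemma min_eq0_mul {R : realDomainType} (x y : R) :
  0 <= x -> 0 <= y -> (Num.min x y == 0) = (x * y == 0).
Proof.
move=> x0 y0; rewrite mulf_eq0.
case: (leP x y) => xy.
  by apply/idP/orP => [->|[//|/eqP y_0]]; [left | rewrite eq_le x0 -y_0 xy].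
by rewrite (gt_eqF (le_lt_trans y0 xy)).
Qed.

Lemma hyp_meet_eq0 {R : realType} {z w : hyperbolic R} :
  0 <= z -> 0 <= w -> Order.meet z w = 0 <-> z * w = 0.
Proof.
rewrite !hyp_leE pi1_0 pi2_0 => /andP[z1 z2] /andP[w1 w2].
split=> zw; apply: hyp_eqP; rewrite ?pi1_0 ?pi2_0; apply/eqP.
- by rewrite pi1M -min_eq0_mul // -pi1_meet zw pi1_0.
- by rewrite pi2M -min_eq0_mul // -pi2_meet zw pi2_0.
- by rewrite pi1_meet min_eq0_mul // -pi1M zw pi1_0.
- by rewrite pi2_meet min_eq0_mul // -pi2M zw pi2_0.
Qed.

(** The hyperbolic numbers have zero divisors, so the factor that vanishes may differ between the
    two components. The signs of [e] and [1 - e] let both be pulled out of [jmod] later. *)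
Lemma hyp_mul_eq0_split {R : realType} {z w : hyperbolic R} : z * w = 0 ->
  exists e : hyperbolic R, [/\ 0 <= e, 0 <= 1 - e, e * z = 0 & (1 - e) * w = 0].
Proof.
move=> zw0.
have zw1 : pi1 z * pi1 w = 0 by rewrite -pi1M zw0 pi1_0.
have zw2 : pi2 z * pi2 w = 0 by rewrite -pi2M zw0 pi2_0.
have split0 (x y : R) : x * y = 0 ->
    exists c : R, [/\ 0 <= c, 0 <= 1 - c, c * x = 0 & (1 - c) * y = 0].
  move=> /eqP; rewrite mulf_eq0 => /orP[] /eqP ->.
    (* The coefficient is 1 where [x] vanishes and 0 where [y] does. *)
    by exists 1; rewrite subrr mulr0 mul0r ler01 lexx.
  by exists 0; rewrite subr0 mulr0 mul0r ler01 lexx.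
have [a [a0 a1 az aw]] := split0 _ _ zw1.
have [b [b0 b1 bz bw]] := split0 _ _ zw2.
(* This holds because [hyp_e1 + hyp_e2 = 1]. *)
have e1 : 1 - idem a b = idem (1 - a) (1 - b).
  by rewrite /idem; congr Hyp => /=; field.
exists (idem a b); rewrite e1; split.
- by rewrite hyp_leE pi1_idem pi2_idem pi1_0 pi2_0 a0.
- by rewrite hyp_leE pi1_idem pi2_idem pi1_0 pi2_0 a1.
- by apply: hyp_eqP; rewrite ?pi1M ?pi2M ?pi1_idem ?pi2_idem ?pi1_0 ?pi2_0.
- by apply: hyp_eqP; rewrite ?pi1M ?pi2M ?pi1_idem ?pi2_idem ?pi1_0 ?pi2_0.
Qed.

Lemma hyp_sqr_ge0 {R : realType} (z : hyperbolic R) : 0 <= z ^+ 2.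
Proof.
by rewrite hyp_leE expr2 pi1M pi2M pi1_0 pi2_0 -!expr2 !sqr_ge0.
Qed.

Lemma jmod_ge0 {R : realType} (v : bicomplex R) : 0 <= jmod v.
Proof. exact: hyp_sqrt_ge0. Qed.

Lemma sqr_jmod {R : realType} (v : bicomplex R) :
  jmod v ^+ 2 = Rej v ^+ 2 + Imj v ^+ 2.
Proof.
apply: sqr_hyp_sqrt; apply: le_trans (hyp_sqr_ge0 (Rej v)) _.
by rewrite -[leLHS]addr0 hyp_leD2l hyp_sqr_ge0.
Qed.

(** The right-hand side is nonnegative and has the correct square, so uniqueness of the nonnegative
    square root applies. *)
Lemma jmod_hypM {R : realType} (z : hyperbolic R) (v : bicomplex R) :
  0 <= z -> jmod (bic_of_hyp z * v) = z * jmod v.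
Proof.
move=> z0; symmetry; apply: hyp_sqrt_unique.
  exact: hyp_mul_ge0 z0 (jmod_ge0 v).
by rewrite exprMn sqr_jmod /=; ring.
Qed.

(** The product of the two moduli is [z * jmod u * jmod v], which is 0 whatever [v] is. *)
Lemma perp_hypM {R : realType} (z : hyperbolic R) (u v : bicomplex R) :
  0 <= z -> z * jmod u = 0 -> perp u (bic_of_hyp z * v).
Proof.
move=> z0 zu; apply/hyp_meet_eq0; [exact: jmod_ge0 | exact: jmod_ge0 |].
by rewrite jmod_hypM // mulrA [jmod u * z]mulrC zu mul0r.
Qed.

Theorem proposition3p3 (R : realType) (psi phi : bicomplex R)
    (h : Order.meet (jmod psi) (jmod phi) = 0) :
  [set: bicomplex R] = [set a + b | a in perp psi & b in perp phi].
Proof.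
move: h => /(hyp_meet_eq0 (jmod_ge0 _) (jmod_ge0 _)) /hyp_mul_eq0_split.
case=> e [e0 e1 epsi ephi]; apply/seteqP; split=> // w _.
exists (bic_of_hyp e * w); first exact: perp_hypM.
exists (bic_of_hyp (1 - e) * w); first exact: perp_hypM.
by case: w => x y; congr Bic => /=; ring.
Qed.
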